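(* Assume that $C=(C_\bullet,d,t)$ is a quasi-precyclic $k$-module and $k\supset\mathbb Q$. Then the $k$-linear map $\nu^{T,\natural\natural}:C^\lambda_\bullet\to C^{\natural\natural}_\bullet$ is a chain map (i.e. $(\partial+\delta)\nu^{T,\natural\natural}=\nu^{T,\natural\natural}b$) such that $$\pi^{\natural\natural}\nu^{T,\natural\natural}=1,\qquad \nu^{T,\natural\natural}\pi^{\natural\natural}=1+(\partial+\delta)\varphi^{T,\natural\natural}+\varphi^{T,\natural\natural}(\partial+\delta),\qquad \pi^{\natural\natural}\varphi^{T,\natural\natural}=0 .$$ In particular, we obtain a deformation retract of $C^{\natural\natural}$ to $C^\lambda$.
   Context: $k$ is a unital ring, not assumed commutative; $k$-modules are left modules. A chain map between graded modules with degree $-1$ operators (not assumed square-zero) is a degree $0$ $k$-linear map commuting with these operators; a deformation retract of $C$ to $\bar C$ is given by chain maps $f:C\to\bar C$, $g:\bar C\to C$ with $fg=1$ and $gf$ chain homotopic to $1$. A para-precyclic $k$-module consists of $k$-modules $C_m$, $m\ge0$, face maps $d_j:C_m\to C_{m-1}$ ($0\le j\le m$) with $d_id_j=d_{j-1}d_i$ for $i<j$, and an invertible $k$-linear map $t:C_\bullet\to C_\bullet$ of degree $0$ with $td_i=d_{i+1}t$ for $0\le i\le m-1$ and $d_m=d_0t$ on $C_m$ (notation: $d=d_m$ on $C_m$). Put $T=t^{m+1}$ on $C_m$; it commutes with $d$ and $t$. It is quasi-precyclic if $C_\bullet=\ker(1-T)\oplus\operatorname{ran}(1-T)$; then $\pi^T$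 is the projection onto $\ker(1-T)$ along $\operatorname{ran}(1-T)$, $x^T:=\pi^T(x)$, and $1-T$ is invertible on $\operatorname{ran}(1-T)$. Let $b=\sum_{j=0}^m(-1)^jd_j$, $b'=\sum_{j=0}^{m-1}(-1)^jd_j$, $\tau=(-1)^mt$, $N=1+\tau+\cdots+\tau^m$ on $C_m$. $C^{\natural\natural}=(C^{\natural\natural}_\bullet,\partial+\delta,u^{-2},T)$, $C^{\natural\natural}_m=\bigoplus_{p+q=m}C_qu^p$ ($p,q\ge0$, $u$ a formal variable), operators on $C_\bullet$ act on coefficients, $\partial(xu^{2p+1})=(1-\tau)xu^{2p}$, $\partial(xu^{2p})=Nxu^{2p-1}$ for $p\ge1$, $\partial(xu^0)=0$, $\delta(xu^{2p})=bxu^{2p}$, $\delta(xu^{2p+1})=-b'xu^{2p+1}$; $(\partial+\delta)^2=(1-T)u^{-2}$. $C^\lambda=(C^\lambda_\bullet,b)$, $C^\lambda_m=C_m/\operatorname{ran}(1-\tau)$, with $b$ induced by $b$; $\pi^\lambda:C_\bullet\to C^\lambda_\bullet$ is the canonical projection. $\pi^{\natural\natural}:C^{\natural\natural}_\bullet\to C^\lambda_\bullet$ is $\pi^{\natural\natural}(xu^0)=\pi^\lambda(x)$, $\pi^{\natural\natural}(xu^p)=0$ for $p\ge1$. For $x\in C_m$ put $\hat x=(m+1)^{-1}x$, $\hat Nx=N\hat x$, $\hat Dx=\sum_{j=0}^m(m-j)\tau^j\hat x$. Define $\nu(x)=\hat Nx\,u^0$; $\varphi(xu^{2p})=-\hat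 Dx\,u^{2p+1}$, $\varphi(xu^{2p+1})=-\hat x\,u^{2p+2}$; $\varphi^{\natural\natural}=\sum_{j\ge0}(\varphi\delta)^j\varphi$; $\nu_0^{\natural\natural}=\sum_{j\ge0}(\varphi\delta)^j\nu:C_\bullet\to C^{\natural\natural}_\bullet$ (finite sums on each element). Let $h^{\natural\natural}(xu^{2p})=-N(1-T)^{-1}(x-x^T)u^{2p+1}$, $h^{\natural\natural}(xu^{2p+1})=0$. The map $\pi^T\nu_0^{\natural\natural}$ vanishes on $\operatorname{ran}(1-\tau)$, and $\nu^{T,\natural\natural}:C^\lambda_\bullet\to C^{\natural\natural}_\bullet$ is defined by $\nu^{T,\natural\natural}\pi^\lambda=\pi^T\nu_0^{\natural\natural}$. Finally $\varphi^{T,\natural\natural}=h^{\natural\natural}+\varphi^{\natural\natural}\pi^T:C^{\natural\natural}_\bullet\to C^{\natural\natural}_{\bullet+1}$. *)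

(* Defs.v *)
From HB Require Import structures.
From mathcomp Require Import all_boot all_order all_algebra.
From mathcomp Require Import boolp classical_sets.

Set Implicit Arguments.
Unset Strict Implicit.
Unset Printing Implicit Defensive.

Import GRing.Theory.
Local Open Scope ring_scope.
Local Open Scope quotient_scope.

Section DirectSum.
Variables (k : nzRingType) (I : finType) (V : I -> lmodType k).

Definition dsum := {dffun forall i, V i}.
HB.instance Definition _ := Choice.on dsum.

Implicit Types x y z : dsum.
Definition dsum0 : dsum := [ffun i => 0].
Definition dsum_opp x : dsum := [ffun i => - x i].
Definition dsum_add x y : dsum := [ffun i => x i + y i].
Definition dsum_scale (a : k) x : dsum := [ffun i => a *: x i].

Fact dsum_addA : associative dsum_add.
Proof. by move=> x y z; apply/ffunP => i; rewrite !ffunE addrA. Qed.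
Fact dsum_addC : commutative dsum_add.
Proof. by move=> x y; apply/ffunP => i; rewrite !ffunE addrC. Qed.
Fact dsum_add0 : left_id dsum0 dsum_add.
Proof. by move=> x; apply/ffunP => i; rewrite !ffunE add0r. Qed.
Fact dsum_addN : left_inverse dsum0 dsum_opp dsum_add.
Proof. by move=> x; apply/ffunP => i; rewrite !ffunE addNr. Qed.
HB.instance Definition _ :=
  GRing.isZmodule.Build dsum dsum_addA dsum_addC dsum_add0 dsum_addN.

Fact dsum_scaleA a b x : dsum_scale a (dsum_scale b x) = dsum_scale (a * b) x.
Proof. by apply/ffunP => i; rewrite !ffunE scalerA. Qed.
Fact dsum_scale1 : left_id 1 dsum_scale.
Proof. by move=> x; apply/ffunP => i; rewrite !ffunE scale1r. Qed.
Fact dsum_scaleDr : right_distributive dsum_scale +%R.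
Proof. by move=> a x y; apply/ffunP => i; rewrite !ffunE scalerDr. Qed.
Fact dsum_scaleDl x : {morph dsum_scale^~ x : a b / a + b}.
Proof. by move=> a b; apply/ffunP => i; rewrite !ffunE scalerDl. Qed.
HB.instance Definition _ := GRing.Zmodule_isLmodule.Build k dsum
  dsum_scaleA dsum_scale1 dsum_scaleDr dsum_scaleDl.

Lemma dsumD x y i : (x + y) i = x i + y i. Proof. exact: ffunE. Qed.
Lemma dsumZ a x i : (a *: x) i = a *: x i. Proof. exact: ffunE. Qed.

End DirectSum.

Section Cokernel.
Variables (k : nzRingType) (U V : lmodType k) (f : {linear U -> V}).

Definition range_pred : {pred V} := [pred y | `[< exists x, y = f x >]].

Lemma range_predP y : reflect (exists x, y = f x) (y \in range_pred).
Proof. by rewrite inE; apply: asboolP. Qed.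

Fact range_zmod_closed : zmod_closed range_pred.
Proof.
split=> [|_ _ /range_predP[x ->] /range_predP[y ->]]; apply/range_predP.
  by exists 0; rewrite linear0.
by exists (x - y); rewrite linearB.
Qed.
HB.instance Definition _ :=
  GRing.isZmodClosed.Build V range_pred range_zmod_closed.

Definition coker := Quotient.quot range_pred.
HB.instance Definition _ := GRing.Zmodule.on coker.

Definition coker_pi (x : V) : coker := \pi_(Quotient.quot range_pred) x.

Lemma coker_eqP x y : coker_pi x = coker_pi y <-> exists z, x - y = f z.
Proof.
split=> [/eqP|H]; [rewrite -Quotient.idealrBE|apply/eqP; rewrite -Quotient.idealrBE];
by [move/range_predP | apply/range_predP].
Qed.

Lemma coker_reprK (y : coker) : coker_pi (repr y) = y.
Proof. exact: reprK. Qed.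

Fact coker_piD : {morph coker_pi : x y / x + y}.
Proof. by move=> x y; rewrite /coker_pi; exact: Quotient.pi_add. Qed.

Definition coker_scale (a : k) (y : coker) : coker := coker_pi (a *: repr y).

Fact coker_scale_pi a x : coker_scale a (coker_pi x) = coker_pi (a *: x).
Proof.
apply/coker_eqP; have /coker_eqP[z Hz] := coker_reprK (coker_pi x).
by exists (a *: z); rewrite -scalerBr Hz linearZ.
Qed.

Fact coker_scaleA a b y : coker_scale a (coker_scale b y) = coker_scale (a * b) y.
Proof. by rewrite -(coker_reprK y) !coker_scale_pi scalerA. Qed.
Fact coker_scale1 : left_id 1 coker_scale.
Proof. by move=> y; rewrite -(coker_reprK y) coker_scale_pi scale1r. Qed.
Fact coker_scaleDr : right_distributive coker_scale +%R.
Proof.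
move=> a x y; rewrite -(coker_reprK x) -(coker_reprK y).
by rewrite -coker_piD !coker_scale_pi scalerDr coker_piD.
Qed.
Fact coker_scaleDl y : {morph coker_scale^~ y : a b / a + b}.
Proof.
by move=> a b; rewrite -(coker_reprK y) !coker_scale_pi scalerDl coker_piD.
Qed.
HB.instance Definition _ := GRing.Zmodule_isLmodule.Build k coker
  coker_scaleA coker_scale1 coker_scaleDr coker_scaleDl.

Fact coker_pi_linear : linear coker_pi.
Proof. by move=> a x y; rewrite coker_piD -coker_scale_pi. Qed.
HB.instance Definition _ :=
  GRing.isLinear.Build k V coker _ coker_pi coker_pi_linear.

End Cokernel.

(* Graded modules are families indexed by nat, and an operator of degree -1
   is given by its components X m.+1 -> X m; its component on X 0 is zero. *)

Section Graded.
Variable k : nzRingType.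
Implicit Types X Y : nat -> lmodType k.

(* The composite h \o D of an operator D of degree -1 and a map h of degree 1. *)
Definition down_up X Y (D : forall m, X m.+1 -> X m)
    (h : forall m, X m -> Y m.+1) (m : nat) : X m -> Y m :=
  match m with
  | 0 => fun=> 0
  | m'.+1 => fun x => h m' (D m' x)
  end.

Definition is_chain_map X Y (D : forall m, X m.+1 -> X m)
    (E : forall m, Y m.+1 -> Y m) (f : forall m, X m -> Y m) : Prop :=
  (forall m, linear (f m)) /\
  (forall m (x : X m.+1), E m (f m.+1 x) = f m (D m x)).

Definition is_chain_homotopy X Y (D : forall m, X m.+1 -> X m)
    (E : forall m, Y m.+1 -> Y m) (f g : forall m, X m -> Y m)
    (h : forall m, X m -> Y m.+1) : Prop :=
  (forall m, linear (h m)) /\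
  (forall m (x : X m), f m x = g m x + E m (h m x) + down_up D h x).

Definition is_deformation_retract X Y (D : forall m, X m.+1 -> X m)
    (E : forall m, Y m.+1 -> Y m)
    (f : forall m, X m -> Y m) (g : forall m, Y m -> X m) : Prop :=
  [/\ is_chain_map D E f,
      is_chain_map E D g,
      forall m (y : Y m), f m (g m y) = y
    & exists h : forall m, X m -> X m.+1,
        is_chain_homotopy D D (fun m x => g m (f m x)) (fun m x => x) h].

End Graded.

Record paraPrecyclic (k : nzRingType) := ParaPrecyclic {
  pp_mod :> nat -> lmodType k;
  face : forall m, 'I_m.+2 -> {linear pp_mod m.+1 -> pp_mod m};
  rot : forall m, {linear pp_mod m -> pp_mod m};
  face_face : forall m (i j : nat) (x : pp_mod m.+2), (i < j <= m.+2)%N ->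
    face (inord i) (face (inord j) x) = face (inord j.-1) (face (inord i) x);
  rot_bij : forall m, bijective (rot m);
  rot_face : forall m (i : nat) (x : pp_mod m.+1), (i <= m)%N ->
    rot m (face (inord i) x) = face (inord i.+1) (rot m.+1 x);
  face_max : forall m (x : pp_mod m.+1),
    face ord_max x = face ord0 (rot m.+1 x)
}.

Arguments face {k} C {m} j : rename.
Arguments rot {k} C {m} : rename.

Section Operators.
Variables (k : nzRingType) (C : paraPrecyclic k).

Definition Tpow m (x : C m) : C m := iter m.+1 (rot C) x.

Definition tau m (x : C m) : C m := (-1) ^+ m *: rot C x.

Definition bop m (x : C m.+1) : C m :=
  \sum_(j < m.+2) (-1) ^+ j *: face C j x.

Definition bop' m (x : C m.+1) : C m :=
  \sum_(j < m.+1) (-1) ^+ j *: face C (inord j) x.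

Definition Nop m (x : C m) : C m := \sum_(j < m.+1) iter j (@tau m) x.

Definition one_minus_tau m (x : C m) : C m := x - tau x.

Fact tau_linear m : linear (@tau m).
Proof.
move=> a x y; rewrite /tau linearP scalerDr !scalerA; congr (_ *: _ + _).
by rewrite commr_sign.
Qed.
HB.instance Definition _ m :=
  GRing.isLinear.Build k (C m) (C m) _ (@tau m) (@tau_linear m).

Fact one_minus_tau_linear m : linear (@one_minus_tau m).
Proof. by move=> a x y; rewrite /one_minus_tau linearP opprD addrACA scalerBr. Qed.
HB.instance Definition _ m := GRing.isLinear.Build k (C m) (C m) _
  (@one_minus_tau m) (@one_minus_tau_linear m).

Definition in_ran1T m (x : C m) : Prop := exists z, x = z - Tpow z.

Definition quasi_precyclic : Prop := forall m,
  (forall x : C m, exists y z, [/\ Tpow y = y, in_ran1T z & x = y + z]) /\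
  (forall x : C m, Tpow x = x -> in_ran1T x -> x = 0).

(* The projection onto ker (1 - T) along ran (1 - T), meaningful when C is
   quasi-precyclic. *)
Definition piT m (x : C m) : C m :=
  xget 0 [set y | Tpow y = y /\ in_ran1T (x - y)].

(* The inverse of the restriction of 1 - T to ran (1 - T), meaningful when C
   is quasi-precyclic. *)
Definition inv1T m (w : C m) : C m :=
  xget 0 [set v | in_ran1T v /\ v - Tpow v = w].

Definition Clambda (m : nat) : lmodType k := coker (@one_minus_tau m).

Definition pi_lambda m : C m -> Clambda m := coker_pi (@one_minus_tau m).

Definition b_lambda m (y : Clambda m.+1) : Clambda m :=
  pi_lambda (bop (repr y)).

Lemma bop_one_minus_tau m (x : C m.+1) :
  bop (one_minus_tau x) = one_minus_tau (bop' x).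
Proof.
have bB y z : bop (y - z) = bop y - bop z :> C m.
  by rewrite /bop -sumrB; apply: eq_bigr => j _; rewrite linearB scalerBr.
rewrite /one_minus_tau bB.
have -> : bop x = bop' x + (-1) ^+ m.+1 *: face C ord_max x.
  rewrite /bop big_ord_recr /=; congr (_ + _); apply: eq_bigr => j _.
  by congr (_ *: face C _ _); apply/val_inj; rewrite /= inordK // ltnS ltnW.
suff -> : bop (tau x) = (-1) ^+ m.+1 *: face C ord_max x + tau (bop' x).
  by rewrite opprD addrA addrK.
rewrite /bop big_ord_recl /= expr0 scale1r; congr (_ + _).
  by rewrite /tau linearZZ face_max.
rewrite /bop' linear_sum /=; apply: eq_bigr => j _.
have le_jm : (j <= m)%N by rewrite -ltnS.
have -> : lift ord0 j = inord j.+1 by apply/val_inj; rewrite /= inordK.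
transitivity ((-1) ^+ j *: tau (face C (inord j) x)); last first.
  by rewrite linearZZ.
rewrite /tau [in LHS]linearZZ rot_face // !scalerA; congr (_ *: _).
by rewrite /= !exprS mulN1r mulNr mulN1r mulrN opprK.
Qed.

Lemma b_lambda_pi m (x : C m.+1) : b_lambda (pi_lambda x) = pi_lambda (bop x).
Proof.
have /coker_eqP[z Hz] := coker_reprK (pi_lambda x).
apply/coker_eqP; exists (bop' z); rewrite /= -bop_one_minus_tau -[one_minus_tau z]Hz.
by rewrite /bop -sumrB; apply: eq_bigr => j _; rewrite linearB scalerBr.
Qed.

(* An element of degree m of the direct sum of the C_q u^p, p + q = m, is the
   family of its coefficients indexed by q <= m: the coefficient of index q is
   that of u^(m - q). *)
Definition Cnat (m : nat) : lmodType k := dsum (fun q : 'I_m.+1 => C q).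

(* The coefficient in C q, extended by 0 for q > m. *)
Definition coef m (xi : Cnat m) (q : nat) : C q :=
  match @idP (q < m.+1)%N with
  | ReflectT lt_q => xi (Ordinal lt_q)
  | ReflectF _ => 0
  end.

Definition mkCnat m (F : forall q, C q) : Cnat m := [ffun q : 'I_m.+1 => F q].

Lemma coef_ord m (xi : Cnat m) (q : 'I_m.+1) : coef xi q = xi q.
Proof.
case: q => q lt_qm; rewrite /coef /=.
by case: {-}_ / idP => [H|/(_ lt_qm)//]; rewrite (bool_irrelevance H lt_qm).
Qed.

Lemma coef_mk m (F : forall q, C q) q :
  coef (mkCnat m F) q = if (q <= m)%N then F q else 0.
Proof.
rewrite /coef; case: {-}_ / idP => [H|/negP H].
  by rewrite ffunE -ltnS H.
by rewrite -ltnS (negbTE H).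
Qed.

(* The element x u^p. *)
Definition xu p q (x : C q) : Cnat (p + q) :=
  mkCnat (p + q) (dfwith (fun n => 0 : C n) x).

(* Lowers the exponent of u: the coefficient of u^p in the result comes from
   that of u^(p + 1), and in particular the coefficient of u^0 is killed. *)
Definition partial m (xi : Cnat m.+1) : Cnat m :=
  mkCnat m (fun q => if odd (m.+1 - q) then one_minus_tau (coef xi q)
                     else Nop (coef xi q)).

Definition delta m (xi : Cnat m.+1) : Cnat m :=
  mkCnat m (fun q => if odd (m - q) then - bop' (coef xi q.+1)
                     else bop (coef xi q.+1)).

Definition dtot m (xi : Cnat m.+1) : Cnat m := partial xi + delta xi.

Definition piTnat m (xi : Cnat m) : Cnat m :=
  mkCnat m (fun q => piT (coef xi q)).

Definition pinat m (xi : Cnat m) : Clambda m := pi_lambda (coef xi m).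

(* Raises the exponent of u by 1, and acts on the coefficient x in C q of u^p
   by F p q; the coefficient of u^0 in the result is 0. *)
Definition raise (F : nat -> forall q, C q -> C q) m (xi : Cnat m) : Cnat m.+1 :=
  mkCnat m.+1 (fun q => if (q <= m)%N then F (m - q)%N q (coef xi q) else 0).

Definition hnat m : Cnat m -> Cnat m.+1 :=
  @raise (fun p q x => if odd p then 0 else - Nop (inv1T (x - piT x))) m.

(* The inclusion of Q in k is a ring morphism from rat to k. *)
Variable incl : {rmorphism rat -> k}.

Definition hat m (x : C m) : C m := incl (m.+1%:R^-1) *: x.

Definition Nhat m (x : C m) : C m := Nop (hat x).

Definition Dhat m (x : C m) : C m :=
  \sum_(j < m.+1) iter j (@tau m) (hat x) *+ (m - j).

Definition nu m (x : C m) : Cnat m := xu 0 (Nhat x).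

Definition phi m : Cnat m -> Cnat m.+1 :=
  @raise (fun p q x => if odd p then - hat x else - Dhat x) m.

Definition phi_delta m (xi : Cnat m) : Cnat m := down_up (@delta) (@phi) xi.

(* The sum of all (phi delta)^j: the terms with j > m vanish in degree m, see
   phi_delta_nilp. *)
Definition phi_delta_sum m (xi : Cnat m) : Cnat m :=
  \sum_(j < m.+1) iter j (@phi_delta m) xi.

Definition phinat m (xi : Cnat m) : Cnat m.+1 := phi_delta_sum (phi xi).

Definition nu0nat m (x : C m) : Cnat m := phi_delta_sum (nu x).

Definition nuT m (y : Clambda m) : Cnat m := piTnat (nu0nat (repr y)).

Definition phiT m (xi : Cnat m) : Cnat m.+1 := hnat xi + phinat (piTnat xi).

Lemma coef_oob m (xi : Cnat m) q : (m < q)%N -> coef xi q = 0.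
Proof. by rewrite /coef; case: {-}_ / idP => // H; rewrite ltnNge -ltnS H. Qed.

Lemma cnatP m (xi eta : Cnat m) :
  (forall q, (q <= m)%N -> coef xi q = coef eta q) -> xi = eta.
Proof.
by move=> H; apply/ffunP => q; rewrite -!coef_ord H // -ltnS ltn_ord.
Qed.

Lemma coefD m (xi eta : Cnat m) q :
  coef (xi + eta) q = coef xi q + coef eta q.
Proof. by rewrite /coef; case: {-}_ / idP => ?; rewrite ?addr0 ?dsumD. Qed.

Lemma coef0 m q : coef (0 : Cnat m) q = 0.
Proof. by rewrite /coef; case: {-}_ / idP => ? //; rewrite ffunE. Qed.

Fact hat0 m : hat (0 : C m) = 0. Proof. exact: scaler0. Qed.

Fact iter_tau0 m j : iter j (@tau m) 0 = 0.
Proof. by elim: j => //= j ->; rewrite raddf0. Qed.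

Fact Dhat0 m : Dhat (0 : C m) = 0.
Proof. by rewrite /Dhat hat0 big1 // => j _; rewrite iter_tau0 mul0rn. Qed.

Fact bop0 m : bop (0 : C m.+1) = 0.
Proof. by rewrite /bop big1 // => j _; rewrite raddf0 scaler0. Qed.

Fact bop'0 m : bop' (0 : C m.+1) = 0.
Proof. by rewrite /bop' big1 // => j _; rewrite raddf0 scaler0. Qed.

Fact Nop0 m : Nop (0 : C m) = 0.
Proof. by rewrite /Nop big1 // => j _; rewrite iter_tau0. Qed.

Lemma coef_xu p q (x : C q) : coef (xu p x) q = x.
Proof. by rewrite coef_mk leq_addl dfwith_in. Qed.

Lemma coef_xu_neq p q (x : C q) n : q != n -> coef (xu p x) n = 0.
Proof. by move=> neq; rewrite coef_mk dfwith_out // if_same. Qed.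

Lemma partial_xu p q (x : C q) :
  partial (xu p.+1 x) = xu p (if odd p.+1 then one_minus_tau x else Nop x).
Proof.
apply: cnatP => n le_n; rewrite coef_mk le_n.
have [<-{n le_n}|neq] := eqVneq q n.
  rewrite (coef_xu p.+1 x) coef_xu.
  by have -> : ((p + q).+1 - q)%N = p.+1 by rewrite -addSn addnK.
by rewrite (coef_xu_neq p.+1 x neq) coef_xu_neq // Nop0 /one_minus_tau raddf0 subr0 if_same.
Qed.

Lemma partial_xu0 q (x : C q.+1) : partial (xu 0 x : Cnat q.+1) = 0.
Proof.
apply: cnatP => n le_n; rewrite coef_mk le_n coef0 (coef_xu_neq 0 x).
  by rewrite Nop0 /one_minus_tau raddf0 subr0 if_same.
by apply: contraTneq le_n => <-; rewrite ltnn.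
Qed.

Lemma phi_xu p q (x : C q) :
  phi (xu p x) = xu p.+1 (if odd p then - hat x else - Dhat x).
Proof.
apply: cnatP => n le_n; rewrite coef_mk le_n.
have [<-{n le_n}|neq] := eqVneq q n.
  by rewrite coef_xu (coef_xu p.+1) leq_addl addnK.
by rewrite coef_xu_neq // (coef_xu_neq p.+1) // hat0 Dhat0 oppr0 !if_same.
Qed.

Lemma phi_delta_nilp m (xi : Cnat m) j :
  (m < j)%N -> iter j (@phi_delta m) xi = 0.
Proof.
move=> lt_mj; apply: cnatP => q _; rewrite coef0.
suff {lt_mj} H i p : (m < p + i)%N -> coef (iter i (@phi_delta m) xi) p = 0.
  by apply: H; rewrite (leq_trans lt_mj) // leq_addl.
elim: i p => [|i IH] p; first by rewrite addn0; apply: coef_oob.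
rewrite addnS -addSn /= => /IH; set eta := iter i _ _; case: m xi @eta {IH} => [|m] xi eta E.
  by rewrite /phi_delta /= coef0.
rewrite /phi_delta /= /phi /raise !coef_mk; case: ifP => // _; case: ifP => // le_pm.
rewrite le_pm E bop0 bop'0 oppr0 !if_same.
by rewrite hat0 Dhat0 oppr0 if_same.
Qed.

Fact Tpow_linear m : linear (@Tpow m).
Proof.
move=> a x y; rewrite /Tpow; elim: m.+1 => //= n ->.
by rewrite linearP.
Qed.
HB.instance Definition _ m :=
  GRing.isLinear.Build k (C m) (C m) _ (@Tpow m) (@Tpow_linear m).

Lemma Tpow_rot m (x : C m) : Tpow (rot C x) = rot C (Tpow x).
Proof. by rewrite /Tpow -iterSr. Qed.

Lemma Tpow_face m (j : 'I_m.+2) (x : C m.+1) :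
  Tpow (face C j x) = face C j (Tpow x).
Proof.
have shift n i y : (i + n <= m.+1)%N ->
    iter n (rot C) (face C (inord i) y) =
    face C (inord (i + n)) (iter n (rot C) y) :> C m.
  elim: n => [|n IH]; first by rewrite addn0.
  rewrite addnS => le_in; rewrite /= IH ?(ltnW le_in) //.
  by rewrite rot_face.
have le_j : (j <= m.+1)%N by rewrite -ltnS.
have e0 : ord0 = inord 0 :> 'I_m.+2 by apply/val_inj; rewrite /= inordK.
have emax : inord m.+1 = ord_max :> 'I_m.+2.
  by apply/val_inj; rewrite /= inordK.
set n := (m.+1 - j)%N; have jn : (j + n)%N = m.+1 by rewrite subnKC.
have -> : Tpow (face C j x) = iter (j + n) (rot C) (face C j x).
  by rewrite /Tpow jn.
have -> : Tpow x = iter (j + n.+1) (rot C) x by rewrite /Tpow addnS jn.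
rewrite !iterD; have -> : iter n (rot C) (face C j x) =
    face C ord0 (iter n.+1 (rot C) x).
  by rewrite -{1}[j]inord_val shift jn ?emax ?face_max.
by rewrite e0 shift add0n ?inord_val.
Qed.

Definition eq1T m (x y : C m) : Prop := in_ran1T (x - y).

Fact eq1T_refl m (x : C m) : eq1T x x.
Proof. by exists 0; rewrite raddf0 !subrr. Qed.

Fact eq1T_add m (x y x' y' : C m) :
  eq1T x y -> eq1T x' y' -> eq1T (x + x') (y + y').
Proof.
move=> [z Hz] [z' Hz']; exists (z + z').
by rewrite opprD addrACA Hz Hz' raddfD opprD addrACA.
Qed.

Fact eq1T_scale m a (x y : C m) : eq1T x y -> eq1T (a *: x) (a *: y).
Proof. by move=> [z Hz]; exists (a *: z); rewrite -scalerBr Hz linearZZ scalerBr. Qed.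

Fact eq1T_opp m (x y : C m) : eq1T x y -> eq1T (- x) (- y).
Proof. by rewrite -!scaleN1r; apply: eq1T_scale. Qed.

Fact eq1T_sum m (I : Type) (r : seq I) (F G : I -> C m) :
  (forall i, eq1T (F i) (G i)) -> eq1T (\sum_(i <- r) F i) (\sum_(i <- r) G i).
Proof. by move=> H; apply: big_ind2; [exact: eq1T_refl|exact: eq1T_add|]. Qed.

Fact eq1T_muln m (x y : C m) n : eq1T x y -> eq1T (x *+ n) (y *+ n).
Proof. by rewrite -!scaler_nat; apply: eq1T_scale. Qed.

Fact eq1T_iter_tau m n (x y : C m) :
  eq1T x y -> eq1T (iter n (@tau m) x) (iter n (@tau m) y).
Proof.
move=> H; elim: n => //= n [z Hz]; apply: eq1T_scale.
by exists (rot C z); rewrite -linearB Hz linearB Tpow_rot.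
Qed.

Fact eq1T_face m (j : 'I_m.+2) (x y : C m.+1) :
  eq1T x y -> eq1T (face C j x) (face C j y).
Proof. by move=> [z Hz]; exists (face C j z); rewrite -linearB Hz linearB Tpow_face. Qed.

Fact eq1T_phi_delta m (xi eta : Cnat m) :
  (forall q, eq1T (coef xi q) (coef eta q)) ->
  forall q, eq1T (coef (phi_delta xi) q) (coef (phi_delta eta) q).
Proof.
case: m xi eta => [|m] xi eta H q; first exact: eq1T_refl.
rewrite /phi_delta /=.
have Hd p : eq1T (coef (delta xi) p) (coef (delta eta) p).
  rewrite !coef_mk; case: ifP => _; last exact: eq1T_refl.
  by case: ifP => _; [apply: eq1T_opp|]; apply: eq1T_sum => j;
    apply/eq1T_scale/eq1T_face/H.
move: (delta xi) (delta eta) Hd => a c Hd; rewrite !coef_mk.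
case: ifP => _; last exact: eq1T_refl.
case: ifP => _; last exact: eq1T_refl.
case: ifP => _; apply: eq1T_opp; first exact: eq1T_scale.
by apply: eq1T_sum => j; apply/eq1T_muln/eq1T_iter_tau/eq1T_scale.
Qed.

Fact eq1T_nu0nat m (x y : C m) : eq1T (Nhat x) (Nhat y) ->
  forall q, eq1T (coef (nu0nat x) q) (coef (nu0nat y) q).
Proof.
move=> H; rewrite /nu0nat /phi_delta_sum => q.
have coef_sum (F : 'I_m.+1 -> Cnat m) :
    coef (\sum_j F j) q = \sum_j coef (F j) q.
  by apply: (big_morph (fun xi => coef xi q)) => [xi eta|];
    [exact: coefD|exact: coef0].
rewrite !coef_sum; apply: eq1T_sum => j.
elim: (j : nat) q {coef_sum} => [|i IH] q /=; last exact: eq1T_phi_delta.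
rewrite !coef_mk; case: ifP => _; last exact: eq1T_refl.
case: dfwithP; first by rewrite dfwith_in.
by move=> p neq_mp; rewrite dfwith_out //; exact: eq1T_refl.
Qed.

Lemma iter_tau_Tpow m (x : C m) : iter m.+1 (@tau m) x = Tpow x.
Proof.
have H n : iter n (@tau m) x = (-1) ^+ (m * n) *: iter n (rot C) x.
  elim: n => [|n IH]; first by rewrite muln0 scale1r.
  by rewrite /= IH /tau linearZZ scalerA -exprD mulnS.
by rewrite H -signr_odd oddM oddS andbN scale1r.
Qed.

Lemma Nop_one_minus_tau m (x : C m) : Nop (one_minus_tau x) = x - Tpow x.
Proof.
rewrite -iter_tau_Tpow /Nop -opprB.
have := telescope_sumr (fun j => iter j (@tau m) x) (leq0n m.+1).
rewrite big_mkord => <-; rewrite -sumrN; apply: eq_bigr => j _.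
rewrite opprB iterSr /one_minus_tau.
by elim: (j : nat) => [|i IH] //=; rewrite IH linearB.
Qed.

Lemma piT_eq m (x y : C m) : eq1T x y -> piT x = piT y.
Proof.
suff sub (x' y' : C m) : eq1T x' y' ->
    forall w, in_ran1T (y' - w) -> in_ran1T (x' - w).
  move=> xy; rewrite /piT; congr (xget 0 _); apply/seteqP.
  split=> w [Tw Hw]; split=> //; apply: sub Hw => //.
  by have := eq1T_opp xy; rewrite /eq1T opprK addrC.
move=> [z Hz] w [v Hv]; exists (z + v).
by rewrite linearD opprD addrACA -Hz -Hv addrA subrK.
Qed.

(* nuT does not depend on the choice of representatives. *)
Lemma nuT_pi m (x : C m) : nuT (pi_lambda x) = piTnat (nu0nat x).
Proof.
have /coker_eqP := coker_reprK (pi_lambda x).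
rewrite -/(pi_lambda x) /nuT; set y := repr _ => -[z Hz].
have H : eq1T (Nhat y) (Nhat x).
  exists (hat z); rewrite -Nop_one_minus_tau.
  have -> : one_minus_tau (hat z) = hat y - hat x.
    by rewrite /hat -scalerBr Hz linearZZ.
  rewrite /Nhat /Nop -sumrB; apply: eq_bigr => j _.
  by elim: (j : nat) => //= i <-; rewrite linearB.
apply: cnatP => q le_qm; rewrite !coef_mk le_qm.
exact/piT_eq/eq1T_nu0nat.
Qed.

End Operators.

(* Main.v *)
From HB Require Import structures.
From mathcomp Require Import all_boot all_order all_algebra.
From mathcomp Require Import boolp classical_sets.
Require Import Defs.

Set Implicit Arguments.
Unset Strict Implicit.
Unset Printing Implicit Defensive.

Import GRing.Theory.
Local Open Scope ring_scope.

(** The proof has two steps: homological perturbation on an arbitrary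
    para-precyclic module, then projection onto the [T]-invariants.

    Write [A = sum_j (phi delta)^j], the inverse of [1 - phi delta], so that
    [phinat = A phi] and [nu0nat = A nu], and write [d = partial + delta].
    The three operators [partial], [delta], [phi] satisfy, on every
    para-precyclic module,
      [delta^2 = 0],   [partial delta + delta partial = 0],
      [nu p = 1 + partial phi + phi partial]   where [p (x u^0) = x]
    and [p] kills the positive powers of [u]
    ([delta_delta], [partial_delta], [nu_homotopy]); here [d^2] may be nonzero,
    and [p] takes values in [C] rather than in [C^lambda].  They imply
      [(1 - phi delta) d = partial (1 - phi delta) + nu p delta]
    ([dtot_perturb]).  Conjugating by [A], and using that [p delta] only sees
    the coefficient of [u^0], which is zero on the image of [phi] and unchanged
    by [A], one gets [d A phi = A partial phi] and [d A nu = A nu b Nhat]; then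
    applying [A] to the homotopy formula gives the identity
      [nu0nat p = 1 + d phinat + phinat d]
    ([nu0nat_homotopy]).

    If [C] is quasi-precyclic, [pi^T] commutes with every operator that
    commutes with [T], and a direct computation with [(1 - tau) N = 1 - T] and
    [b' N = N b] gives [pi^T = 1 + d hnat + hnat d] ([piTnat_homotopy]).
    Applying [pi^T] to the identity for [nu0nat] and inserting this one yields
    the homotopy formula of the theorem.  That [nuT] is a chain map and
    a section of [pinat] comes from the fact that [Nhat] and [pi^T] act as the
    identity on [C^lambda]: both [1 - Nhat] and [1 - pi^T] factor through
    [1 - tau].  Finally [pinat phiT] vanishes because [phiT] raises the power
    of [u]. *)

(** * Face operators and the cyclic operator *)

Lemma exchange_triangle (V : nmodType) n (F : nat -> nat -> V) :
  \sum_(0 <= i < n) \sum_(0 <= j < i.+1) F i j =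
  \sum_(0 <= j < n) \sum_(j <= i < n) F i j.
Proof.
under eq_big_nat => i lt_in do rewrite (big_nat_widen 0 i.+1 n) //.
under [RHS]eq_bigr => j _ do rewrite (big_nat_widenl j 0 n) //.
by rewrite (exchange_big_dep_nat xpredT).
Qed.

Section Faces.
Variables (k : nzRingType) (C : paraPrecyclic k).

(** With the sign absorbed, moving a face past [tau] carries no sign
    ([tau_signed_face]), also for the last face ([signed_face_last]). *)
Definition signed_face m i (x : C m.+1) : C m := (-1) ^+ i *: face C (inord i) x.

Fact signed_face_linear m i : linear (@signed_face m i).
Proof.
move=> a x y; rewrite /signed_face linearP scalerDr !scalerA; congr (_ *: _ + _).
by rewrite commr_sign.
Qed.
HB.instance Definition _ m i := GRing.isLinear.Build k (C m.+1) (C m) _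
  (@signed_face m i) (@signed_face_linear m i).

Lemma bopE m (x : C m.+1) : bop x = \sum_(0 <= i < m.+2) signed_face i x.
Proof.
by rewrite big_mkord; apply: eq_bigr => i _; rewrite /signed_face inord_val.
Qed.

Lemma bop'E m (x : C m.+1) : bop' x = \sum_(0 <= i < m.+1) signed_face i x.
Proof. by rewrite big_mkord. Qed.

Fact bop_linear m : linear (@bop k C m).
Proof.
move=> a x y; rewrite !bopE scaler_sumr -big_split /=.
by apply: eq_bigr => i _; rewrite linearP.
Qed.
HB.instance Definition _ m := GRing.isLinear.Build k (C m.+1) (C m) _
  (@bop k C m) (@bop_linear m).

Fact bop'_linear m : linear (@bop' k C m).
Proof.
move=> a x y; rewrite !bop'E scaler_sumr -big_split /=.
by apply: eq_bigr => i _; rewrite linearP.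
Qed.
HB.instance Definition _ m := GRing.isLinear.Build k (C m.+1) (C m) _
  (@bop' k C m) (@bop'_linear m).

Fact iter_tau_linear m j : linear (iter j (@tau k C m)).
Proof. by move=> a x y; elim: j => //= j ->; rewrite linearP. Qed.
HB.instance Definition _ m j := GRing.isLinear.Build k (C m) (C m) _
  (iter j (@tau k C m)) (@iter_tau_linear m j).

Fact Nop_linear m : linear (@Nop k C m).
Proof.
move=> a x y; rewrite /Nop scaler_sumr -big_split /=.
by apply: eq_bigr => i _; rewrite linearP.
Qed.
HB.instance Definition _ m := GRing.isLinear.Build k (C m) (C m) _
  (@Nop k C m) (@Nop_linear m).

Lemma NopE m (x : C m) : Nop x = \sum_(0 <= j < m.+1) iter j (@tau k C m) x.
Proof. by rewrite big_mkord. Qed.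

Lemma signed_face_signed_face m i j (x : C m.+2) :
  (i < j <= m.+2)%N ->
  signed_face i (signed_face j x) = - signed_face j.-1 (signed_face i x).
Proof.
case: j => // j lt_ij; rewrite /signed_face !linearZZ !scalerA face_face //=.
by rewrite scalerN -scaleNr -!exprD addnS exprS mulN1r addnC.
Qed.

(** The truncation at [n] covers [bop] and [bop'] at once.  The terms with
    [j <= i] cancel those with [j > i], by [signed_face_signed_face] and
    exchange of the two summations. *)
Lemma sum_signed_face_signed_face m n (x : C m.+2) : (n <= m.+2)%N ->
  \sum_(0 <= i < n) \sum_(0 <= j < n.+1) signed_face i (signed_face j x) = 0.
Proof.
move=> le_nm.
under eq_big_nat => i lt_in do rewrite (@big_cat_nat _ _ _ i.+1) ?(leqW lt_in) //=.
rewrite big_split /= exchange_triangle -big_split big_nat big1 //= => i lt_in.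
rewrite big_add1 -big_split big_nat big1 //= => j /andP[le_ij lt_jn].
rewrite [X in _ + X]signed_face_signed_face /= ?addrN //.
by rewrite ltnS le_ij (leq_trans _ le_nm).
Qed.

Lemma bop_bop m (x : C m.+2) : bop (bop x) = 0.
Proof.
rewrite !bopE -[RHS](sum_signed_face_signed_face x (leqnn _)).
by apply: eq_bigr => i _; rewrite linear_sum.
Qed.

Lemma bop'_bop' m (x : C m.+2) : bop' (bop' x) = 0.
Proof.
rewrite !bop'E -[RHS](sum_signed_face_signed_face x (leqnSn _)).
by apply: eq_bigr => i _; rewrite linear_sum.
Qed.

Lemma tau_signed_face m i (x : C m.+1) : (i <= m)%N ->
  tau (signed_face i x) = signed_face i.+1 (tau x).
Proof.
move=> le_im; rewrite /tau /signed_face !linearZZ !scalerA rot_face //.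
congr (_ *: _).
by rewrite -!exprD -signr_odd -[RHS]signr_odd !oddD /= addNb addbN negbK addbC.
Qed.

Lemma signed_face_last m (x : C m.+1) : signed_face m.+1 x = signed_face 0 (tau x).
Proof.
rewrite /signed_face /tau linearZZ scale1r; congr (_ *: _).
have -> : inord m.+1 = ord_max :> 'I_m.+2 by apply/val_inj; rewrite /= inordK.
by rewrite face_max; congr (face _ _ _); apply/val_inj; rewrite /= inordK.
Qed.

Lemma iter_tau_signed_face m i n (x : C m.+1) : (i + n <= m.+1)%N ->
  iter n (@tau k C m) (signed_face i x) =
  signed_face (i + n) (iter n (@tau k C m.+1) x).
Proof.
elim: n => [|n IHn]; first by rewrite addn0.
by rewrite addnS => le_in; rewrite /= IHn ?(ltnW le_in) // tau_signed_face.
Qed.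

(** Every term of the left side is moved into the form
    [tau^l o signed_face r]: for [j <= i], [signed_face i o tau^j] has [l = j]
    and [r = i - j]; for [j > i] the face wraps around once, which gives
    [l = j - 1] and [r = m + 2 + i - j].  For fixed [l] the two ranges of [r]
    are [r < m + 1 - l] and [m + 1 - l <= r <= m + 1]. *)
Lemma bop'_Nop m (x : C m.+1) : bop' (Nop x) = Nop (bop x).
Proof.
rewrite bop'E !NopE bopE.
under eq_big_nat => i /andP[_ lt_im].
  rewrite linear_sum (@big_cat_nat _ _ _ i.+1) ?(leqW lt_im) //= big_add1 /=.
  over.
under [RHS]eq_big_nat => l /andP[_ lt_lm].
  rewrite linear_sum (@big_cat_nat _ _ _ (m.+1 - l)) ?(leqW (leq_subr _ _)) //=.
  over.
rewrite !big_split /=; congr (_ + _).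
  rewrite exchange_triangle; apply: eq_big_nat => l /andP[_ lt_lm].
  rewrite -{1}[l]add0n big_addn; apply: eq_big_nat => i /andP[_ lt_im].
  by rewrite iter_tau_signed_face // ltnW // addnC -ltn_subRL.
rewrite -exchange_triangle; apply: eq_big_nat => l /andP[_ lt_lm].
rewrite -[X in _ = \sum_(X <= _ < _) _]add0n big_addn subnBA 1?ltnW // addSnnS addKn.
apply: eq_big_nat => i /andP[_ lt_il].
have def_l : l = (i + (l - i))%N by rewrite subnKC.
(* The face of index i reaches index 0 after i steps and reappears as the last
   face, which the remaining r = l - i powers of tau bring down to m + 1 - r. *)
move: (l - i)%N def_l lt_lm => r -> lt_irm {l lt_il}.
rewrite -iterS -addnS !iterD -[X in signed_face X]add0n -iter_tau_signed_face;
  last first.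
  by rewrite add0n ltnW // (leq_ltn_trans _ lt_irm) ?leq_addr.
rewrite iterS -signed_face_last; congr (iter i _ _).
have le_rm : (r <= m.+1)%N by rewrite ltnW // (leq_ltn_trans _ lt_irm) ?leq_addl.
by rewrite addnBA ?(ltnW lt_irm) // subnDl iter_tau_signed_face subnK.
Qed.

Lemma one_minus_tau_Nop m (x : C m) : one_minus_tau (Nop x) = x - Tpow x.
Proof.
rewrite -Nop_one_minus_tau /one_minus_tau linearB; congr (_ - _).
by rewrite /Nop linear_sum; apply: eq_bigr => j _; rewrite -iterS iterSr.
Qed.

End Faces.

(** * Averaging over the cyclic group *)

Section Hat.
Variables (k : nzRingType) (incl : {rmorphism rat -> k}) (C : paraPrecyclic k).

Lemma natr_incl_inv m : m.+1%:R * incl m.+1%:R^-1 = 1.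
Proof.
rewrite -(rmorph_nat incl) -rmorphM divff ?rmorph1 //.
by rewrite Num.Theory.pnatr_eq0.
Qed.

(** Integers are central in any ring, hence so are their inverses; this is what
    makes [hat] a [k]-linear map when [k] is not commutative. *)
Lemma incl_inv_central m a : GRing.comm (incl m.+1%:R^-1) a.
Proof.
set u := incl _; have nu1 : m.+1%:R * u = 1 by apply: natr_incl_inv.
have un1 : u * m.+1%:R = 1 by rewrite (commr_nat u).
rewrite /GRing.comm -[RHS]mul1r -un1 -mulrA [_%:R * _]mulrA -(commr_nat a).
by rewrite !mulrA -[_ * _%:R * u]mulrA nu1 mulr1.
Qed.

Fact hat_linear m : linear (@hat k C incl m).
Proof.
by move=> a x y; rewrite /hat scalerDr !scalerA incl_inv_central.
Qed.
HB.instance Definition _ m := GRing.isLinear.Build k (C m) (C m) _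
  (@hat k C incl m) (@hat_linear m).

Lemma hat_muln m (x : C m) : hat incl x *+ m.+1 = x.
Proof. by rewrite -scaler_nat /hat scalerA natr_incl_inv scale1r. Qed.

Fact Nhat_linear m : linear (@Nhat k C incl m).
Proof. by move=> a x y; rewrite /Nhat !linearP. Qed.
HB.instance Definition _ m := GRing.isLinear.Build k (C m) (C m) _
  (@Nhat k C incl m) (@Nhat_linear m).

Fact Dhat_linear m : linear (@Dhat k C incl m).
Proof.
move=> a x y; rewrite /Dhat scaler_sumr -big_split /=.
by apply: eq_bigr => j _; rewrite !linearP mulrnDl scalerMnr.
Qed.
HB.instance Definition _ m := GRing.isLinear.Build k (C m) (C m) _
  (@Dhat k C incl m) (@Dhat_linear m).

(** In [(1 - tau) (sum_j (m - j) tau^j)] the coefficient of [1] is [m], those of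
    [tau], ..., [tau^m] are [-1], and that of [tau^(m+1)] is 0. *)
Lemma one_minus_tau_Dhat m (x : C m) :
  one_minus_tau (Dhat incl x) = x - Nhat incl x.
Proof.
rewrite /one_minus_tau /Dhat /Nhat -[X in _ = X - _](hat_muln x).
move: (hat incl x) => y; rewrite linear_sum /Nop /=.
rewrite big_ord_recl /= subn0 [X in _ - X = _]big_ord_recr /= subnn linear0 addr0.
rewrite [X in _ = _ - X]big_ord_recl /= mulrSr opprD addrA addrK.
rewrite -addrA -sumrB -sumrN; congr (_ + _); apply: eq_bigr => j _.
rewrite /bump /= add1n linearMn /= subnS.
have : (0 < m - j)%N by rewrite subn_gt0.
by case: (m - j)%N => // n _; rewrite /= mulrSr opprD addNKr.
Qed.

Lemma Dhat_one_minus_tau m (x : C m) :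
  Dhat incl (one_minus_tau x) = x - Nhat incl x.
Proof.
rewrite -one_minus_tau_Dhat /one_minus_tau [LHS]linearB /=; congr (_ - _).
rewrite /Dhat [RHS]linear_sum; apply: eq_bigr => j _.
by rewrite linearMn /= -iterS iterSr /hat [tau (_ *: _)]linearZZ.
Qed.

End Hat.

(** * Perturbation of the contraction by delta *)

Section Total.
Variables (k : nzRingType) (incl : {rmorphism rat -> k}) (C : paraPrecyclic k).

Lemma coefP m q a (xi eta : Cnat C m) :
  coef (a *: xi + eta) q = a *: coef xi q + coef eta q.
Proof.
rewrite coefD; congr (_ + _).
by rewrite /coef; case: {-}_ / idP => ?; rewrite ?scaler0 ?dsumZ.
Qed.

Lemma coefN m q (xi : Cnat C m) : coef (- xi) q = - coef xi q.
Proof. by rewrite -[- xi]addr0 -scaleN1r coefP scaleN1r coef0 addr0. Qed.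

Fact partial_linear m : linear (@partial k C m).
Proof.
move=> a xi eta; apply: cnatP => q le_qm.
by rewrite coefP !coef_mk le_qm coefP; case: ifP => _; rewrite linearP.
Qed.
HB.instance Definition _ m := GRing.isLinear.Build k (Cnat C m.+1) (Cnat C m) _
  (@partial k C m) (@partial_linear m).

Fact delta_linear m : linear (@delta k C m).
Proof.
move=> a xi eta; apply: cnatP => q le_qm.
rewrite coefP !coef_mk le_qm coefP.
by case: ifP => _; rewrite linearP // opprD scalerN.
Qed.
HB.instance Definition _ m := GRing.isLinear.Build k (Cnat C m.+1) (Cnat C m) _
  (@delta k C m) (@delta_linear m).

Fact dtot_linear m : linear (@dtot k C m).
Proof. by move=> a xi eta; rewrite /dtot !linearP scalerDr addrACA. Qed.
HB.instance Definition _ m := GRing.isLinear.Build k (Cnat C m.+1) (Cnat C m) _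
  (@dtot k C m) (@dtot_linear m).

Fact phi_linear m : linear (@phi k C incl m).
Proof.
move=> a xi eta; apply: cnatP => q le_qm.
rewrite coefP !coef_mk le_qm; case: ifP => _; last by rewrite scaler0 addr0.
by rewrite coefP; case: ifP => _; rewrite linearP opprD scalerN.
Qed.
HB.instance Definition _ m := GRing.isLinear.Build k (Cnat C m) (Cnat C m.+1) _
  (@phi k C incl m) (@phi_linear m).

Lemma coef_nu m (x : C m) q : (q < m)%N -> coef (nu incl x) q = 0.
Proof. by move=> lt_qm; rewrite (coef_xu_neq 0) // gtn_eqF. Qed.

Lemma coef_nu_top m (x : C m) : coef (nu incl x) m = Nhat incl x.
Proof. exact: (coef_xu 0). Qed.

Fact nu_linear m : linear (@nu k C incl m).
Proof.
move=> a x y; apply: cnatP => q; rewrite leq_eqVlt coefP => /predU1P[->|lt_qm].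
  by rewrite !coef_nu_top; exact: Nhat_linear.
by rewrite !coef_nu // scaler0 addr0.
Qed.
HB.instance Definition _ m := GRing.isLinear.Build k (C m) (Cnat C m) _
  (@nu k C incl m) (@nu_linear m).

Fact phi_delta_linear m : linear (@phi_delta k C incl m).
Proof.
case: m => [|m] a xi eta; rewrite /phi_delta /=; first by rewrite scaler0 addr0.
by rewrite !linearP.
Qed.
HB.instance Definition _ m := GRing.isLinear.Build k (Cnat C m) (Cnat C m) _
  (@phi_delta k C incl m) (@phi_delta_linear m).

Fact phi_delta_sum_linear m : linear (@phi_delta_sum k C incl m).
Proof.
move=> a xi eta; rewrite /phi_delta_sum scaler_sumr -big_split /=.
by apply: eq_bigr => j _; elim: (j : nat) => //= i ->; rewrite linearP.
Qed.
HB.instance Definition _ m := GRing.isLinear.Build k (Cnat C m) (Cnat C m) _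
  (@phi_delta_sum k C incl m) (@phi_delta_sum_linear m).

Lemma phi_delta_sumE m (xi : Cnat C m) :
  phi_delta_sum incl xi = xi + phi_delta incl (phi_delta_sum incl xi).
Proof.
rewrite {2}/phi_delta_sum linear_sum big_ord_recr /= -iterS phi_delta_nilp //.
by rewrite addr0 /phi_delta_sum big_ord_recl.
Qed.

Lemma phi_delta_sumK m (xi : Cnat C m) :
  phi_delta_sum incl (xi - phi_delta incl xi) = xi.
Proof.
rewrite linearB /= {1}phi_delta_sumE -addrA; apply/eqP; rewrite addrC -subr_eq0.
rewrite addrK subr_eq0 /phi_delta_sum linear_sum; apply/eqP.
by apply: eq_bigr => j _; rewrite -iterS iterSr.
Qed.

Lemma delta_delta m (xi : Cnat C m.+2) : delta (delta xi) = 0.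
Proof.
apply: cnatP => q le_qm; rewrite coef0 !coef_mk le_qm ltnS le_qm subSS.
by case: odd; rewrite ?bop_bop // linearN /= bop'_bop' !oppr0.
Qed.

Lemma partial_delta m (xi : Cnat C m.+2) : partial (delta xi) = - delta (partial xi).
Proof.
apply: cnatP => q le_qm; rewrite coefN !coef_mk le_qm ltnS le_qm leqW // !subSS.
rewrite subSn //=; case: odd => /=.
  by rewrite opprK bop'_Nop.
by rewrite linearN /= bop_one_minus_tau.
Qed.

(** The unperturbed contraction: [coef xi m] is the coefficient of [u^0].  In
    each power of [u] it amounts to [one_minus_tau_Dhat] or
    [Dhat_one_minus_tau]. *)
Lemma nu_homotopy m (xi : Cnat C m) :
  nu incl (coef xi m) =
  xi + partial (phi incl xi) + down_up (@partial k C) (@phi k C incl) xi.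
Proof.
apply: cnatP => q le_qm; rewrite !coefD [coef (partial _) q]coef_mk le_qm.
rewrite subSn //= [coef (phi _ _) _]coef_mk leqW // le_qm.
move: le_qm; rewrite leq_eqVlt => /predU1P[->|lt_qm].
  rewrite subnn /= coef_nu_top linearN /= one_minus_tau_Dhat.
  have -> : coef (down_up (@partial k C) (@phi k C incl) xi) m = 0.
    by case: m xi => [|m] xi; rewrite /= ?coef0 // coef_mk leqnn ltnn.
  by rewrite addr0 opprB addrC subrK.
rewrite coef_nu //; case: m xi lt_qm => // m xi lt_qm /=.
rewrite !coef_mk ltnW // -ltnS lt_qm subSn //=; case: odd => /=.
  rewrite linearN /= one_minus_tau_Dhat opprB [_ + (_ - _)]addrC subrK.
  by rewrite /Nhat /hat linearZZ subrr.
rewrite linearN /= -/(Nhat incl _) Dhat_one_minus_tau opprB.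
by rewrite -addrA addKr subrr.
Qed.

(** By [nu_homotopy], [nu p delta - delta - partial phi delta] is
    [phi partial delta], which equals [- phi delta d] because [delta] squares to
    zero and anticommutes with [partial]. *)
Lemma dtot_perturb m (xi : Cnat C m.+1) :
  dtot xi - phi_delta incl (dtot xi) =
  partial (xi - phi_delta incl xi) + nu incl (coef (delta xi) m).
Proof.
have E : down_up (@partial k C) (@phi k C incl) (delta xi) =
    - phi_delta incl (dtot xi).
  case: m xi => [|m] xi; rewrite /phi_delta /= ?oppr0 //.
  by rewrite /dtot linearD /= delta_delta addr0 partial_delta linearN.
rewrite nu_homotopy E linearB /= /dtot addrA; congr (_ - _).
by rewrite [delta xi + _]addrC addrA subrK.
Qed.

(** [dtot_perturb] conjugated by [A]. *)
Lemma dtot_sum m (xi : Cnat C m.+1) :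
  dtot (phi_delta_sum incl xi) = phi_delta_sum incl
    (partial xi + nu incl (bop (coef (phi_delta_sum incl xi) m.+1))).
Proof.
rewrite -[LHS](phi_delta_sumK (dtot _)) dtot_perturb; congr (phi_delta_sum _ _).
have -> : phi_delta_sum incl xi - phi_delta incl (phi_delta_sum incl xi) = xi.
  by rewrite {1}phi_delta_sumE addrK.
by congr (_ + nu _ _); rewrite coef_mk leqnn subnn.
Qed.

Lemma coef_phi_top m (xi : Cnat C m) : coef (phi incl xi) m.+1 = 0.
Proof. by rewrite coef_mk leqnn ltnn. Qed.

(** Every term of [A] other than the identity is [phi] applied to something,
    and [phi] raises the power of [u]. *)
Lemma coef_phi_delta_sum_top m (xi : Cnat C m) :
  coef (phi_delta_sum incl xi) m = coef xi m.
Proof.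
rewrite phi_delta_sumE coefD; case: m xi => [|m] xi.
  by rewrite /phi_delta /= coef0 addr0.
by rewrite /phi_delta /= coef_phi_top addr0.
Qed.

Lemma dtot_phinat m (xi : Cnat C m) :
  dtot (phinat incl xi) = phi_delta_sum incl (partial (phi incl xi)).
Proof.
by rewrite /phinat dtot_sum coef_phi_delta_sum_top coef_phi_top !linear0 addr0.
Qed.

Lemma dtot_nu0nat m (x : C m.+1) :
  dtot (nu0nat incl x) = nu0nat incl (bop (Nhat incl x)).
Proof.
rewrite /nu0nat dtot_sum coef_phi_delta_sum_top coef_nu_top.
by rewrite [partial _]partial_xu0 add0r.
Qed.

(** This is [A] applied to [nu_homotopy], with [A partial phi = d A phi] and
    [A = 1 + A phi delta]. *)
Lemma nu0nat_homotopy m (xi : Cnat C m) :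
  nu0nat incl (coef xi m) =
  xi + dtot (phinat incl xi) + down_up (@dtot k C) (@phinat k C incl) xi.
Proof.
rewrite /nu0nat nu_homotopy !linearD /= dtot_phinat -addrA [RHS]addrAC.
rewrite [LHS]addrCA [RHS]addrC; congr (_ + _).
have -> : phi_delta_sum incl xi = xi + phi_delta_sum incl (phi_delta incl xi).
  by apply/eqP; rewrite -subr_eq -linearB /= phi_delta_sumK.
rewrite -addrA; congr (_ + _); case: m xi => [|m] xi.
  by rewrite /phi_delta /= linear0 addr0.
by rewrite /phi_delta /= -linearD -linearD addrC.
Qed.

End Total.

(** * The projection onto the T-invariants *)

Section Equivariance.
Variables (k : nzRingType) (incl : {rmorphism rat -> k}) (C : paraPrecyclic k).

Definition equivariant m n (f : C m -> C n) :=
  {morph f : x / Tpow x >-> Tpow x}.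

Lemma tau_equivariant m : equivariant (@tau k C m).
Proof. by move=> x; rewrite /tau [RHS]linearZZ /= Tpow_rot. Qed.

Lemma one_minus_tau_equivariant m : equivariant (@one_minus_tau k C m).
Proof. by move=> x; rewrite /one_minus_tau [RHS]linearB /= -tau_equivariant. Qed.

Lemma iter_tau_equivariant m j : equivariant (iter j (@tau k C m)).
Proof. by move=> x; elim: j => //= j ->; rewrite tau_equivariant. Qed.

Lemma Nop_equivariant m : equivariant (@Nop k C m).
Proof.
by move=> x; rewrite /Nop [RHS]linear_sum; apply: eq_bigr => j _;
  rewrite iter_tau_equivariant.
Qed.

Lemma signed_face_equivariant m i : equivariant (@signed_face k C m i).
Proof. by move=> x; rewrite /signed_face [RHS]linearZZ /= Tpow_face. Qed.

Lemma bop_equivariant m : equivariant (@bop k C m).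
Proof.
by move=> x; rewrite !bopE [RHS]linear_sum; apply: eq_bigr => i _;
  rewrite signed_face_equivariant.
Qed.

Lemma bop'_equivariant m : equivariant (@bop' k C m).
Proof.
by move=> x; rewrite !bop'E [RHS]linear_sum; apply: eq_bigr => i _;
  rewrite signed_face_equivariant.
Qed.

Lemma hat_equivariant m : equivariant (@hat k C incl m).
Proof. by move=> x; rewrite /hat [RHS]linearZZ. Qed.

Lemma Dhat_equivariant m : equivariant (@Dhat k C incl m).
Proof.
move=> x; rewrite /Dhat [RHS]linear_sum; apply: eq_bigr => j _.
by rewrite linearMn /= -iter_tau_equivariant hat_equivariant.
Qed.

End Equivariance.

Section QuasiPrecyclic.
Variables (k : nzRingType) (C : paraPrecyclic k).
Hypothesis hC : quasi_precyclic C.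

Fact in_ran1T_linear m a (x y : C m) :
  in_ran1T x -> in_ran1T y -> in_ran1T (a *: x + y).
Proof.
move=> [z ->] [w ->]; exists (a *: z + w).
by rewrite linearP scalerBr opprD addrACA.
Qed.

Fact in_ran1TB m (x y : C m) : in_ran1T x -> in_ran1T y -> in_ran1T (x - y).
Proof. by move=> rx ry; rewrite addrC -scaleN1r; apply: in_ran1T_linear. Qed.

Lemma in_ran1T_equivariant m n (f : {linear C m -> C n}) (x : C m) :
  equivariant f -> in_ran1T x -> in_ran1T (f x).
Proof. by move=> fT [z ->]; exists (f z); rewrite linearB /= fT. Qed.

Lemma piTP m (x : C m) : Tpow (piT x) = piT x /\ in_ran1T (x - piT x).
Proof.
apply: (@xgetPex _ 0 [set y | Tpow y = y /\ in_ran1T (x - y)]%classic).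
have [/(_ x)[y [z [Ty rz ->]]] _] := hC m.
by exists y; split=> //; rewrite addrC addKr.
Qed.

Lemma piT_unique m (x y : C m) : Tpow y = y -> in_ran1T (x - y) -> piT x = y.
Proof.
move=> Ty rxy; have [Tp rxp] := piTP x; apply/eqP; rewrite -subr_eq0; apply/eqP.
have [_ disj] := hC m; apply: disj; first by rewrite linearB /= Tp Ty.
by have := in_ran1TB rxy rxp; rewrite opprB addrC addrA subrK.
Qed.

Fact piT_linear m : linear (@piT k C m).
Proof.
move=> a x y; have [Tx rx] := piTP x; have [Ty ry] := piTP y.
apply: piT_unique; first by rewrite linearP /= Tx Ty.
by rewrite opprD addrACA -scalerBr; apply: in_ran1T_linear.
Qed.

Lemma piT_equivariant m n (f : {linear C m -> C n}) (x : C m) :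
  equivariant f -> piT (f x) = f (piT x).
Proof.
move=> fT; have [Tx rx] := piTP x; apply: piT_unique; first by rewrite -fT Tx.
by rewrite -linearB; apply: in_ran1T_equivariant.
Qed.

(** The operator [(1 - T)^-1 (1 - pi^T)], total on [C] and linear, in terms of
    which [hnat] is written. *)
Definition inv1T_proj m (x : C m) : C m := inv1T (x - piT x).

Lemma inv1T_projP m (x : C m) :
  in_ran1T (inv1T_proj x) /\ inv1T_proj x - Tpow (inv1T_proj x) = x - piT x.
Proof.
have [_ [z def_z]] := piTP x; have [Tz rz] := piTP z.
apply: (@xgetPex _ 0 [set v | in_ran1T v /\ v - Tpow v = x - piT x]%classic).
exists (z - piT z); split=> //.
by rewrite linearB /= Tz opprB addrA subrK def_z.
Qed.

Lemma inv1T_proj_unique m (x v : C m) :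
  in_ran1T v -> v - Tpow v = x - piT x -> inv1T_proj x = v.
Proof.
move=> rv def_v; have [rw def_w] := inv1T_projP x.
apply/eqP; rewrite -subr_eq0; apply/eqP; have [_ disj] := hC m.
apply: disj; last exact: in_ran1TB.
apply/esym/eqP; rewrite -subr_eq0; apply/eqP.
by rewrite linearB opprD addrACA -opprD /= def_w def_v subrr.
Qed.

Fact inv1T_proj_linear m : linear (@inv1T_proj m).
Proof.
move=> a x y; have [rx dx] := inv1T_projP x; have [ry dy] := inv1T_projP y.
apply: inv1T_proj_unique; first exact: in_ran1T_linear.
by rewrite piT_linear linearP opprD addrACA -scalerBr dx dy scalerBr addrACA -opprD.
Qed.

Lemma inv1T_proj_equivariant m n (f : {linear C m -> C n}) (x : C m) :
  equivariant f -> inv1T_proj (f x) = f (inv1T_proj x).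
Proof.
move=> fT; have [rx dx] := inv1T_projP x.
apply: inv1T_proj_unique; first exact: in_ran1T_equivariant.
by rewrite -fT -linearB dx linearB /= piT_equivariant.
Qed.

End QuasiPrecyclic.

(** * The deformation retract *)

Section Projection.
Variables (k : nzRingType) (incl : {rmorphism rat -> k}) (C : paraPrecyclic k).
Hypothesis hC : quasi_precyclic C.

Let piT0 m : piT (0 : C m) = 0.
Proof.
apply: (piT_unique hC); first exact: raddf0.
by rewrite subrr; exists 0; rewrite raddf0 subrr.
Qed.

Let piTN m (x : C m) : piT (- x) = - piT x.
Proof. by rewrite -[- x]addr0 -scaleN1r piT_linear // piT0 addr0 scaleN1r. Qed.

Let piTD m (x y : C m) : piT (x + y) = piT x + piT y.
Proof. by rewrite -[x in LHS]scale1r piT_linear // scale1r. Qed.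

Lemma coef_piTnat m (xi : Cnat C m) q : coef (piTnat xi) q = piT (coef xi q).
Proof.
rewrite coef_mk; case: leqP => // lt_mq.
by rewrite coef_oob // piT0.
Qed.

Fact piTnat_linear m : linear (@piTnat k C m).
Proof.
move=> a xi eta; apply: cnatP => q _.
by rewrite coefP !coef_piTnat coefP piT_linear.
Qed.

Lemma piTnatD m (xi eta : Cnat C m) : piTnat (xi + eta) = piTnat xi + piTnat eta.
Proof. by apply: cnatP => q _; rewrite coefD !coef_piTnat coefD piTD. Qed.

Lemma piTnat0 m : piTnat (0 : Cnat C m) = 0.
Proof. by apply: cnatP => q _; rewrite coef_piTnat coef0 piT0. Qed.

Lemma partial_piTnat m (xi : Cnat C m.+1) :
  partial (piTnat xi) = piTnat (partial xi).
Proof.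
apply: cnatP => q le_qm.
rewrite coef_piTnat ![coef (partial _) _]coef_mk le_qm coef_piTnat.
case: ifP => _; rewrite (piT_equivariant hC) //.
  exact: one_minus_tau_equivariant.
exact: Nop_equivariant.
Qed.

Lemma delta_piTnat m (xi : Cnat C m.+1) : delta (piTnat xi) = piTnat (delta xi).
Proof.
apply: cnatP => q le_qm.
rewrite coef_piTnat ![coef (delta _) _]coef_mk le_qm coef_piTnat.
case: ifP => _; rewrite ?piTN (piT_equivariant hC) //.
  exact: bop'_equivariant.
exact: bop_equivariant.
Qed.

Lemma dtot_piTnat m (xi : Cnat C m.+1) : dtot (piTnat xi) = piTnat (dtot xi).
Proof. by rewrite /dtot piTnatD partial_piTnat delta_piTnat. Qed.

Lemma phi_piTnat m (xi : Cnat C m) : phi incl (piTnat xi) = piTnat (phi incl xi).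
Proof.
apply: cnatP => q _; rewrite coef_piTnat ![coef (phi _ _) _]coef_mk.
case: ifP => // _; case: ifP => [le_qm|_]; last by rewrite piT0.
rewrite coef_piTnat; case: ifP => _; rewrite piTN (piT_equivariant hC) //.
  exact: hat_equivariant.
exact: Dhat_equivariant.
Qed.

Lemma phinat_piTnat m (xi : Cnat C m) :
  phinat incl (piTnat xi) = piTnat (phinat incl xi).
Proof.
rewrite /phinat /phi_delta_sum phi_piTnat (big_morph _ (@piTnatD _) (@piTnat0 _)).
apply: eq_bigr => j _; elim: (j : nat) => //= i ->.
by rewrite /phi_delta /= delta_piTnat phi_piTnat.
Qed.

Let inv1T_proj0 m : inv1T_proj (0 : C m) = 0.
Proof.
apply: (inv1T_proj_unique hC); first by exists 0; rewrite linear0 subrr.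
by rewrite piT0 linear0.
Qed.

Let inv1T_projD m (x y : C m) : inv1T_proj (x + y) = inv1T_proj x + inv1T_proj y.
Proof. by rewrite -[x in LHS]scale1r inv1T_proj_linear // scale1r. Qed.

(** For [q > m] both sides vanish, so no bound on [q] is needed: this spares
    the boundary cases in [piTnat_homotopy]. *)
Lemma coef_hnat m (xi : Cnat C m) q : coef (hnat xi) q =
  if odd (m - q) then 0 else - Nop (inv1T_proj (coef xi q)).
Proof.
rewrite coef_mk; have [le_qm|lt_mq] := leqP q m; first by rewrite leqW.
rewrite if_same coef_oob //.
have /eqP-> : (m - q == 0)%N by rewrite subn_eq0 ltnW.
by rewrite inv1T_proj0 linear0 oppr0.
Qed.

Fact hnat_linear m : linear (@hnat k C m).
Proof.
move=> a xi eta; apply: cnatP => q _; rewrite coefP !coef_hnat coefP.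
case: ifP => _; first by rewrite scaler0 addr0.
by rewrite inv1T_proj_linear // linearP opprD scalerN.
Qed.

(** Let [w = (1 - T)^-1 (x - x^T)].  On [x u^(2p)], [partial hnat] gives
    [- (1 - tau) N w = x^T - x] while [delta hnat] and [hnat delta] cancel, as
    [b' N = N b]; on [x u^(2p+1)], [hnat partial] gives
    [- N (1 - tau) w = x^T - x]. *)
Lemma piTnat_homotopy m (xi : Cnat C m) :
  piTnat xi = xi + dtot (hnat xi) + down_up (@dtot k C) (@hnat k C) xi.
Proof.
have projE n (x : C n) : piT x = x - one_minus_tau (Nop (inv1T_proj x)).
  by rewrite one_minus_tau_Nop (inv1T_projP hC x).2 subKr.
apply: cnatP => q le_qm; rewrite coef_piTnat projE !coefD -!addrA; congr (_ + _).
rewrite [coef (partial _) q]coef_mk [coef (delta _) q]coef_mk le_qm !coef_hnat.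
rewrite subSn //; case: m xi le_qm => [|m] xi; rewrite ?leqn0 /=.
  move=> /eqP ->; rewrite coef0 [coef xi 1%N]coef_oob // inv1T_proj0.
  by rewrite linear0 oppr0 [bop 0]linear0 !addr0 [RHS]linearN.
rewrite coef_hnat subSS; rewrite leq_eqVlt => /predU1P[->|lt_qm].
  rewrite subnn ![coef _ m.+2]coef_oob // [coef (dtot xi) _]coef_oob //.
  rewrite !inv1T_proj0 ![Nop 0]linear0 !oppr0 !if_same /=.
  by rewrite [bop 0]linear0 !addr0 [RHS]linearN.
rewrite subSn //=; case: (boolP (odd (m - q))) => odd_p /=.
  by rewrite [bop 0]linear0 !addr0 [RHS]linearN.
rewrite [Nop 0]linear0 add0r.
have -> : coef (dtot xi) q = one_minus_tau (coef xi q) + bop (coef xi q.+1).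
  by rewrite coefD !coef_mk -ltnS lt_qm subSn //= odd_p (negbTE odd_p).
rewrite inv1T_projD !(inv1T_proj_equivariant hC); first last.
- exact: one_minus_tau_equivariant.
- exact: bop_equivariant.
rewrite [bop' _]linearN [Nop (_ + _)]linearD /= opprK bop'_Nop.
rewrite [in RHS]opprD addrCA addrN addr0.
by rewrite one_minus_tau_Nop Nop_one_minus_tau.
Qed.

Fact phiT_linear m : linear (@phiT k C incl m).
Proof.
move=> a xi eta.
rewrite /phiT hnat_linear piTnat_linear /phinat !linearP scalerDr.
by rewrite addrACA.
Qed.

Lemma pinat_phiT m (xi : Cnat C m) : pinat (phiT incl xi) = 0.
Proof.
rewrite /pinat coefD coef_mk ltnn leqnn add0r coef_phi_delta_sum_top coef_phi_top.
exact: linear0.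
Qed.

Lemma pi_lambda_linear m : linear (@pi_lambda k C m).
Proof. exact: coker_pi_linear. Qed.

Fact pinat_linear m : linear (@pinat k C m).
Proof. by move=> a xi eta; rewrite /pinat coefP pi_lambda_linear. Qed.

Lemma pinat_dtot m (xi : Cnat C m.+1) : pinat (dtot xi) = b_lambda (pinat xi).
Proof.
rewrite /pinat b_lambda_pi coefD !coef_mk leqnn subSn // subnn /=.
apply/coker_eqP; exists (coef xi m).
by rewrite addrK.
Qed.

Fact nuT_linear m : linear (@nuT k C incl m).
Proof.
move=> a y z; rewrite -[y]coker_reprK -[z]coker_reprK -!/(pi_lambda _).
rewrite -pi_lambda_linear !nuT_pi -piTnat_linear.
by congr piTnat; rewrite /nu0nat !linearP.
Qed.

Lemma pi_lambda_Nhat m (x : C m) : pi_lambda (Nhat incl x) = pi_lambda x.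
Proof.
apply/coker_eqP; exists (- Dhat incl x).
by rewrite [RHS]linearN /= one_minus_tau_Dhat opprB.
Qed.

Lemma pi_lambda_piT m (x : C m) : pi_lambda (piT x) = pi_lambda x.
Proof.
apply/esym/coker_eqP; exists (Nop (inv1T_proj x)).
by rewrite /= one_minus_tau_Nop (inv1T_projP hC x).2.
Qed.

Lemma nuT_chain m (y : Clambda C m.+1) : dtot (nuT incl y) = nuT incl (b_lambda y).
Proof.
rewrite -[y]coker_reprK -/(pi_lambda _); move: (repr y) => x.
rewrite nuT_pi dtot_piTnat dtot_nu0nat -nuT_pi -b_lambda_pi.
by rewrite pi_lambda_Nhat.
Qed.

Lemma pinat_nuT m (y : Clambda C m) : pinat (nuT incl y) = y.
Proof.
rewrite -[y]coker_reprK -/(pi_lambda _); move: (repr y) => x.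
rewrite nuT_pi /pinat coef_piTnat pi_lambda_piT coef_phi_delta_sum_top.
by rewrite coef_nu_top pi_lambda_Nhat.
Qed.

End Projection.

Theorem proposition9p9 (k : nzRingType) (incl : {rmorphism rat -> k})
    (C : paraPrecyclic k) (hC : quasi_precyclic C) :
  [/\ is_chain_map (@b_lambda k C) (@dtot k C) (@nuT k C incl),
      forall (m : nat) (y : Clambda C m), pinat (nuT incl y) = y,
      forall (m : nat) (xi : Cnat C m),
        nuT incl (pinat xi) =
          xi + dtot (phiT incl xi) + down_up (@dtot k C) (@phiT k C incl) xi,
      forall (m : nat) (xi : Cnat C m), pinat (phiT incl xi) = 0
    & is_deformation_retract (@dtot k C) (@b_lambda k C)
        (@pinat k C) (@nuT k C incl)].
Proof.
have homotopy m (xi : Cnat C m) : nuT incl (pinat xi) =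
    xi + dtot (phiT incl xi) + down_up (@dtot k C) (@phiT k C incl) xi.
  have -> : down_up (@dtot k C) (@phiT k C incl) xi =
      down_up (@dtot k C) (@hnat k C) xi +
      piTnat (down_up (@dtot k C) (@phinat k C incl) xi).
    case: m xi => [|m] xi; first by rewrite /= piTnat0 // addr0.
    by rewrite /= /phiT phinat_piTnat.
  rewrite /pinat nuT_pi nu0nat_homotopy 2!(piTnatD hC) -dtot_piTnat //.
  rewrite -phinat_piTnat // [X in X + _ + _]piTnat_homotopy // /phiT.
  rewrite [dtot (_ + _)]linearD /=.
  (* Generalized because dtot unfolds to a sum, which addrA would reassociate. *)
  move: (dtot (hnat xi)) (dtot (phinat _ _)) (piTnat (down_up _ _ _)) => a b c.
  by rewrite -!addrA; congr (_ + (_ + _)); rewrite addrCA.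
have nuT_chain_map : is_chain_map (@b_lambda k C) (@dtot k C) (@nuT k C incl).
  by split=> [m|m y]; [exact: nuT_linear | exact: nuT_chain].
split=> //; first exact: pinat_nuT; first exact: pinat_phiT.
split=> //; last by exists (@phiT k C incl); split=> // m; exact: phiT_linear.
  by split=> [m|m xi]; [exact: pinat_linear | rewrite pinat_dtot].
exact: pinat_nuT.
Qed.
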